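(* Let $\Gamma$ be a non-amenable countable discrete group with a paradoxical decomposition, i.e. pairwise disjoint subsets $X_1,\dots,X_n,Y_1,\dots,Y_m\subseteq\Gamma$ and elements $g_1,\dots,g_n,h_1,\dots,h_m\in\Gamma$ with $g_1=h_1=e$ such that $$\Gamma=\bigsqcup_{i=1}^n g_iX_i=\bigsqcup_{j=1}^m h_jY_j=\Big(\bigsqcup_{i=1}^n X_i\Big)\sqcup\Big(\bigsqcup_{j=1}^m Y_j\Big).$$ Let $F=\{g_1,\dots,g_n,h_1,\dots,h_m\}$. Then $$C_F\ \geq\ \frac{1}{n+m-2}.$$ In particular, if $\Gamma$ contains a copy of the free group $\mathbb{F}_2$, then choosing a paradoxical decomposition with four pieces ($n+m=4$) yields a set $F$ with $C_F\ge 1/2$. The same statements hold with the modulus of quasidiagonality $\mathrm{qd}(\lambda(F))$ in place of $C_F$; in particular $\mathrm{qd}(\lambda(F))\geq \frac{1}{n+m-2}$.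
   Context: For a countable discrete group $\Gamma$, $\lambda\colon\Gamma\to B(\ell^2\Gamma)$ is the left regular representation, $\lambda_s\delta_t=\delta_{st}$, and $e$ is the neutral element. Let $\mathcal{P}$ be the set of non-zero finite-rank (self-adjoint) projections on $\ell^2\Gamma$, directed by $P\le Q$ iff $PQ=P$. Write $[S,T]=ST-TS$. For a finite subset $F\subset\Gamma$, $$C_F:=\inf_{P\in\mathcal{P}}\ \sup_{x\in F}\|[\lambda_x,P]\|.$$ For a set $\Omega\subset B(\ell^2\Gamma)$, the modulus of quasidiagonality is $$\mathrm{qd}(\Omega):=\liminf_{P\in\mathcal{P}}\ \sup_{T\in\Omega}\|[T,P]\|,$$ where the liminf over the directed set $\mathcal{P}$ means $\sup_{P\in\mathcal P}\inf_{Q\in\mathcal P,\,Q\geq P}$. A paradoxical decomposition as in the claim is said to have $n+m$ pieces. *)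

(* Defs.v *)
From HB Require Import structures.
From mathcomp Require Import all_boot all_order all_algebra.
From mathcomp Require Import all_classical all_reals all_analysis.
From mathcomp Require Import complex ring lra.

Set Implicit Arguments.
Unset Strict Implicit.
Unset Printing Implicit Defensive.

Import Order.TTheory GRing.Theory Num.Theory.
Import Normc ComplexField.

Local Open Scope classical_set_scope.
Local Open Scope ring_scope.

Section SquareSummable.
Variables (R : realType) (G : choiceType).

Definition square_summable (f : G -> R[i]) : Prop :=
  (\esum_(t in [set: G]) (normc (f t) ^+ 2)%:E < +oo)%E.

Definition l2_pred : {pred G -> R[i]} := fun f => `[< square_summable f >].

Lemma normc_sqrD (x y : R[i]) :
  normc (x + y) ^+ 2 <= 2 * normc x ^+ 2 + 2 * normc y ^+ 2.
Proof.
have nx (z : R[i]) : 0 <= normc z by case: z => a b; rewrite /normc sqrtr_ge0.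
have h : normc (x + y) ^+ 2 <= (normc x + normc y) ^+ 2.
  by rewrite ler_sqr ?nnegrE ?addr_ge0// le_normcD.
apply: le_trans h _; rewrite -subr_ge0.
rewrite (_ : _ - _ = (normc x - normc y) ^+ 2) ?sqr_ge0//.
ring.
Qed.

Lemma esumZ_fin (c : R) (a : G -> R) : 0 <= c -> (forall t, 0 <= a t) ->
  (\esum_(t in [set: G]) (a t)%:E < +oo)%E ->
  (\esum_(t in [set: G]) (c * a t)%:E < +oo)%E.
Proof.
move=> c0 a0 afin.
have S0 : (0 <= \esum_(t in [set: G]) (a t)%:E)%E.
  by apply: esum_ge0 => t _; rewrite lee_fin.
apply: (@le_lt_trans _ _ (c%:E * \esum_(t in [set: G]) (a t)%:E)%E); last first.
  by move: afin S0; case: (esum _ _) => [r| |]//= _ _; rewrite -EFinM ltry.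
apply: ge_ereal_sup => _ [A [Afin AT]] <-.
rewrite fsbig_finite//=.
under eq_bigr do rewrite EFinM.
rewrite -ge0_sume_distrr; last by move=> t _; rewrite lee_fin.
apply: lee_wpmul2l; first by rewrite lee_fin.
by apply: ereal_sup_ubound; exists A => //; rewrite fsbig_finite.
Qed.

Lemma l2_submod_closed : submod_closed l2_pred.
Proof.
split.
  apply/asboolP; rewrite /square_summable esum1 ?ltry// => t _.
  by rewrite [normc _](normc0 R) expr0n.
move=> c f g /asboolP ff /asboolP fg; apply/asboolP; rewrite /square_summable.
have n0 (x : R) : 0 <= x ^+ 2 by exact: sqr_ge0.
apply: (@le_lt_trans _ _ (\esum_(t in [set: G])
  ((2 * normc c ^+ 2 * normc (f t) ^+ 2)%:E
   + (2 * normc (g t) ^+ 2)%:E))%E).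
  apply: le_esum => t _; rewrite -EFinD lee_fin.
  apply: le_trans (normc_sqrD _ _) _.
  by rewrite normcM exprMn mulrA.
have p0 (c' : R) (z : R[i]) : 0 <= c' -> (0 <= (c' * normc z ^+ 2)%:E)%E.
  by move=> c'0; rewrite lee_fin mulr_ge0.
have c20 : 0 <= 2 * normc c ^+ 2 by rewrite mulr_ge0.
rewrite esumD => [|t _|t _]; [|exact: p0|exact: p0].
apply: lte_add_pinfty.
  exact: (esumZ_fin (a := fun t => normc (f t) ^+ 2) c20).
exact: (esumZ_fin (a := fun t => normc (g t) ^+ 2)).
Qed.

HB.instance Definition _ := GRing.isSubmodClosed.Build _ _ l2_pred
  l2_submod_closed.

Record l2 := L2 { l2_fun :> G -> R[i] ; l2_funP : l2_fun \in l2_pred }.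

HB.instance Definition _ := [isSub for l2_fun].
HB.instance Definition _ := [Choice of l2 by <:].
HB.instance Definition _ := [SubChoice_isSubLmodule of l2 by <:].

End SquareSummable.

Section Operators.
Variables (R : realType) (G : choiceType).
Local Notation l2 := (l2 R G).

(* Meaningful for absolutely summable families only, which the families in
   [l2_inner] are. *)
Definition rsum (f : G -> R) : R :=
  fine (\esum_(t in [set: G]) (f^\+ t)%:E - \esum_(t in [set: G]) (f^\- t)%:E).

Definition csum (f : G -> R[i]) : R[i] :=
  (rsum (fun t => complex.Re (f t)) +i* rsum (fun t => complex.Im (f t)))%C.

Definition l2_inner (u v : l2) : R[i] := csum (fun t => u t * (v t)^*%C).

Definition l2_norm (u : l2) : R :=
  Num.sqrt (fine (\esum_(t in [set: G]) (normc (u t) ^+ 2)%:E)).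

Record bounded_op := BoundedOp {
  bop_fun :> {linear l2 -> l2} ;
  bop_bounded : exists M : R, forall v, l2_norm (bop_fun v) <= M * l2_norm v }.

Definition op_norm (T : l2 -> l2) : \bar R :=
  ereal_sup [set (l2_norm (T v))%:E | v in [set v | l2_norm v <= 1]].

Definition commutator (S T : l2 -> l2) : l2 -> l2 :=
  (S \o T) \- (T \o S).

Definition finite_rank (T : l2 -> l2) : Prop :=
  exists (k : nat) (e : 'I_k -> l2),
    forall v, exists c : 'I_k -> R[i], T v = \sum_(i < k) c i *: e i.

Definition fin_proj : set bounded_op := [set P : bounded_op |
  [/\ forall v, P (P v) = P v,
      forall u v, l2_inner (P u) v = l2_inner u (P v),
      finite_rank P &
      exists v, P v != 0]].

Definition proj_le (P Q : bounded_op) : Prop := forall v, P (Q v) = P v.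

(* The liminf over a directed set is sup_P inf_(Q >= P). *)
Definition qd (Omega : set bounded_op) : \bar R :=
  ereal_sup [set
    ereal_inf [set
      ereal_sup [set op_norm (commutator T Q) | T in Omega]
    | Q in [set Q | fin_proj Q /\ proj_le P Q]]
  | P in fin_proj].

End Operators.

Section Regular.
Variables (R : realType) (G : groupType).
Local Notation l2 := (l2 R G).

Local Notation trans s f := (fun t => f (s^-1 * t)%g).

(* [trans s] is the operator with lambda_s delta_t = delta_(s t). *)
Lemma trans_delta (s t : G) :
  trans s (fun u => (u == t)%:R) = (fun u => (u == (s * t)%g)%:R) :> (G -> R[i]).
Proof.
apply/funext => u; congr (nat_of_bool _)%:R.
by apply/eqP/eqP => [<-|->]; rewrite ?mulVKg ?mulKg.
Qed.

Lemma esum_trans (a : G -> \bar R) (s : G) : (forall t, 0 <= a t)%E ->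
  (\esum_(t in [set: G]) a (s^-1 * t)%g = \esum_(t in [set: G]) a t)%E.
Proof.
move=> a0; rewrite [RHS](@reindex_esum _ _ _ [set: G] [set: G] (fun t => (s^-1 * t)%g))//.
split=> //; first by move=> ? ? _ _; exact: mulgI.
by move=> t _; exists (s * t)%g; rewrite ?mulKg.
Qed.

Lemma left_reg_subproof (s : G) (f : l2) : trans s f \in @l2_pred R G.
Proof.
apply/asboolP; rewrite /square_summable.
rewrite (esum_trans (a := fun t => (normc (f t) ^+ 2)%:E)); last first.
  by move=> t; rewrite lee_fin sqr_ge0.
exact/asboolP/(l2_funP f).
Qed.

Definition left_reg_fun (s : G) (f : l2) : l2 := L2 (left_reg_subproof s f).

Lemma left_reg_linear s : linear (left_reg_fun s).
Proof. by move=> c f g; apply/val_inj. Qed.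

HB.instance Definition _ s :=
  GRing.isLinear.Build R[i] l2 l2 _ (left_reg_fun s) (left_reg_linear s).

Lemma left_reg_bounded s :
  exists M : R, forall v, l2_norm (left_reg_fun s v) <= M * l2_norm v.
Proof.
exists 1 => v; rewrite mul1r /l2_norm /=.
rewrite (esum_trans (a := fun t => (normc (v t) ^+ 2)%:E))//.
by move=> t; rewrite lee_fin sqr_ge0.
Qed.

Definition left_reg (s : G) : bounded_op R G := BoundedOp (left_reg_bounded s).

(* Suprema are taken in the extended reals, so this is [-oo]
   instead of 0 for empty [F]; likewise for [qd]. *)
Definition commutator_const (F : set G) : \bar R :=
  ereal_inf [set
    ereal_sup [set op_norm (commutator (left_reg x) P) | x in F]
  | P in @fin_proj R G].

End Regular.
Arguments commutator_const R {G} F.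
Arguments left_reg R {G} s.

Definition ltranslate (G : groupType) (g : G) (A : set G) : set G :=
  [set (g * x)%g | x in A].

Definition amenable (R : realType) (G : groupType) : Prop :=
  exists mu : set G -> R,
    [/\ mu [set: G] = 1,
        forall A, 0 <= mu A,
        forall A B, A `&` B = set0 -> mu (A `|` B) = mu A + mu B &
        forall g A, mu (ltranslate g A) = mu A].

Record paradoxical (G : groupType) (n m : nat)
    (g : 'I_n -> G) (X : 'I_n -> set G)
    (h : 'I_m -> G) (Y : 'I_m -> set G) : Prop := Paradoxical {
  paradoxical_g1 : exists n_gt0 : (0 < n)%N, g (Ordinal n_gt0) = 1%g ;
  paradoxical_h1 : exists m_gt0 : (0 < m)%N, h (Ordinal m_gt0) = 1%g ;
  paradoxical_trivX : trivIset [set: 'I_n] X ;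
  paradoxical_trivY : trivIset [set: 'I_m] Y ;
  paradoxical_XY : forall i j, X i `&` Y j = set0 ;
  paradoxical_cover : (\bigcup_i X i) `|` (\bigcup_j Y j) = [set: G] ;
  paradoxical_trivgX : trivIset [set: 'I_n] (fun i => ltranslate (g i) (X i)) ;
  paradoxical_gX : \bigcup_i ltranslate (g i) (X i) = [set: G] ;
  paradoxical_trivhY : trivIset [set: 'I_m] (fun j => ltranslate (h j) (Y j)) ;
  paradoxical_hY : \bigcup_j ltranslate (h j) (Y j) = [set: G] }.

Definition translators (G : groupType) (n m : nat)
    (g : 'I_n -> G) (h : 'I_m -> G) : set G := range g `|` range h.

(* [(i, b)] is the generator [i], inverted if [b]. *)
Definition letter : Type := (bool * bool)%type.
HB.instance Definition _ := Choice.on letter.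

Definition linv (x : letter) : letter := (x.1, ~~ x.2).

Definition reduced (w : seq letter) : bool :=
  sorted (fun x y => y != linv x) w.

(* The reduced form of [x :: w], for [w] reduced. *)
Definition push (x : letter) (w : seq letter) : seq letter :=
  if w is y :: w' then if y == linv x then w' else x :: w else [:: x].

Definition wmul (u v : seq letter) : seq letter := foldr push v u.

Definition winv (w : seq letter) : seq letter := rev (map linv w).

Lemma linvK : involutive linv.
Proof. by case=> i b; rewrite /linv /= negbK. Qed.

Lemma push_reduced x w : reduced w -> reduced (push x w).
Proof.
case: w => //= y w yw; case: ifPn => [_|xy /=]; last by rewrite xy.
exact: path_sorted yw.
Qed.

Lemma pushK x w : reduced w -> push (linv x) (push x w) = w.
Proof.
case: w => [|y w] /=; first by rewrite linvK eqxx.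
case: ifPn => [/eqP-> |_ _] /=; last by rewrite linvK eqxx.
by case: w => //= z w; rewrite linvK => /andP[/negPf->].
Qed.

Lemma wmul_reduced u v : reduced v -> reduced (wmul u v).
Proof. by move=> rv; elim: u => //= x u; exact: push_reduced. Qed.

Lemma wmul_push x u w : reduced w -> wmul (push x u) w = push x (wmul u w).
Proof.
move=> rw; case: u => //= y u; case: ifPn => //= /eqP ->.
by rewrite -{1}(linvK x) pushK// wmul_reduced.
Qed.

Lemma wmulA u v w : reduced w -> wmul u (wmul v w) = wmul (wmul u v) w.
Proof. by move=> rw; elim: u => //= x u ->; rewrite wmul_push. Qed.

Lemma wmul1 u : reduced u -> wmul u [::] = u.
Proof.
elim: u => //= x u IH xu; rewrite IH; last exact: path_sorted xu.
by case: u xu {IH} => //= y u /andP[/negPf->].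
Qed.

Lemma winvK : involutive winv.
Proof. by move=> w; rewrite /winv map_rev revK mapK//; exact: linvK. Qed.

Lemma winv_reduced w : reduced w -> reduced (winv w).
Proof.
rewrite /reduced /winv rev_sorted sorted_map; apply: sub_sorted => x y.
by apply: contraNN => /eqP /= ->; rewrite linvK.
Qed.

Lemma wmulV w : reduced w -> wmul (winv w) w = [::].
Proof.
elim: w => // x w IH xw; rewrite /winv /= rev_cons /wmul foldr_rcons /= linvK eqxx.
exact: IH (path_sorted xw).
Qed.

Record F2 := ReducedWord { F2_word :> seq letter ; F2_wordP : reduced F2_word }.

HB.instance Definition _ := [isSub for F2_word].
HB.instance Definition _ := [Choice of F2 by <:].

Definition F2_one : F2 := @ReducedWord [::] isT.
Definition F2_mul (u v : F2) : F2 := ReducedWord (wmul_reduced u (F2_wordP v)).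
Definition F2_inv (u : F2) : F2 := ReducedWord (winv_reduced (F2_wordP u)).

Lemma F2_mulA : associative F2_mul.
Proof. by move=> u v w; apply/val_inj/wmulA/F2_wordP. Qed.
Lemma F2_mul1g : left_id F2_one F2_mul.
Proof. by move=> u; apply/val_inj. Qed.
Lemma F2_mulg1 : right_id F2_one F2_mul.
Proof. by move=> u; apply/val_inj/wmul1/F2_wordP. Qed.
Lemma F2_mulVg : left_inverse F2_one F2_inv F2_mul.
Proof. by move=> u; apply/val_inj/wmulV/F2_wordP. Qed.
Lemma F2_mulgV : right_inverse F2_one F2_inv F2_mul.
Proof.
move=> u; apply/val_inj => /=; rewrite -{1}(winvK u).
exact/wmulV/winv_reduced/F2_wordP.
Qed.

HB.instance Definition _ :=
  isGroup.Build F2 F2_mulA F2_mul1g F2_mulg1 F2_mulVg F2_mulgV.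

Definition contains_F2 (G : groupType) : Prop :=
  exists phi : {multiplicative F2 -> G}, injective phi.

(* Main.v *)
Require Import Defs.
From HB Require Import structures.
From mathcomp Require Import all_boot all_order all_algebra.
From mathcomp Require Import all_classical all_reals all_analysis.
From mathcomp Require Import complex ring lra.

(** For a projection [P] of rank [k], [mu A = Tr(P 1_A)] is a finitely additive
    measure on the group with total mass [k]. If [||[lambda_s, P]|| <= eps],
    then [mu (sA) - mu A = Tr((lambda_s^* P lambda_s - P) 1_A)] pairs the
    indicator with a difference of two rank [k] projections, of norm at most
    [eps] and trace [0], hence is at most [k eps]. Measuring the group through
    both families of translated pieces then gives
    [2 k <= k + (n + m - 2) k eps], the two pieces translated by the identity
    costing nothing. *)

Set Implicit Arguments.
Unset Strict Implicit.
Unset Printing Implicit Defensive.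

Import Order.TTheory GRing.Theory Num.Theory.
Import Normc ComplexField.
Local Open Scope classical_set_scope.
Local Open Scope ring_scope.

(** * Sums of absolutely summable families *)

Section AbsolutelySummable.
Context {R : realType} {G : choiceType}.
Implicit Types (f g : G -> R) (c : R).

Definition abs_summable f : Prop := summable [set: G] (EFin \o f).

Lemma abs_summable_le f g : (forall t, `|f t| <= `|g t|) ->
  abs_summable g -> abs_summable f.
Proof. by move=> fg; apply: le_lt_trans; apply: le_esum => t _; exact: fg. Qed.

Lemma abs_summableD f g :
  abs_summable f -> abs_summable g -> abs_summable (fun t => f t + g t).
Proof. exact: summableD. Qed.

Lemma abs_summableZ c f : abs_summable f -> abs_summable (fun t => c * f t).
Proof.
move=> sf; rewrite /abs_summable /summable /=.
under eq_esum do rewrite normrM.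
exact: (@esumZ_fin _ _ `|c| (fun t => `|f t|)).
Qed.

Lemma abs_summable_funrpos f : abs_summable f -> abs_summable f^\+.
Proof. by move/summable_funepos; rewrite funerpos. Qed.

Lemma abs_summable_funrneg f : abs_summable f -> abs_summable f^\-.
Proof. by move/summable_funeneg; rewrite funerneg. Qed.

Lemma abs_summable_esum_fin f : (forall t, 0 <= f t) -> abs_summable f ->
  (\esum_(t in [set: G]) (f t)%:E)%E \is a fin_num.
Proof.
move=> f0; rewrite /abs_summable summableE.
by under eq_esum do rewrite /= ger0_norm//.
Qed.

(** [rsum] is defined through the positive and negative parts of a family; here any splitting into
    two non-negative summable families may be used instead. Additivity needs this freedom, because
    the positive part of a sum need not be the sum of the positive parts. *)
Lemma rsum_sub_ge0 f g : (forall t, 0 <= f t) -> (forall t, 0 <= g t) ->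
  abs_summable f -> abs_summable g ->
  rsum (fun t => f t - g t) =
  fine (\esum_(t in [set: G]) (f t)%:E) - fine (\esum_(t in [set: G]) (g t)%:E).
Proof.
move=> f0 g0 sf sg; rewrite -fineB ?abs_summable_esum_fin//.
rewrite -[in RHS](esumB sf sg) => [|t _|t _]; rewrite ?lee_fin//.
rewrite /rsum; congr (fine (_ - _)%E); apply: eq_esum => t _.
  exact/esym/(congr1 (@^~ t) (funerpos (fun t => f t - g t))).
exact/esym/(congr1 (@^~ t) (funerneg (fun t => f t - g t))).
Qed.

Lemma rsum_posneg f : abs_summable f ->
  rsum f = fine (\esum_(t in [set: G]) (f^\+ t)%:E) -
           fine (\esum_(t in [set: G]) (f^\- t)%:E).
Proof.
move=> sf; rewrite /rsum fineB// abs_summable_esum_fin//.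
- exact: abs_summable_funrpos.
- exact: abs_summable_funrneg.
Qed.

Lemma rsum_ge0 f : (forall t, 0 <= f t) ->
  rsum f = fine (\esum_(t in [set: G]) (f t)%:E).
Proof.
move=> f0; rewrite /rsum; congr fine.
rewrite [X in (_ - X)%E]esum1 ?sube0.
  by apply: eq_esum => t _; rewrite (ge0_funrposE (D := setT)) ?inE.
by move=> t _; rewrite (ge0_funrnegE (D := setT)) ?inE.
Qed.

Lemma rsumD f g : abs_summable f -> abs_summable g ->
  rsum (fun t => f t + g t) = rsum f + rsum g.
Proof.
move=> sf sg.
have [spf snf] := (abs_summable_funrpos sf, abs_summable_funrneg sf).
have [spg sng] := (abs_summable_funrpos sg, abs_summable_funrneg sg).
rewrite [LHS](_ : _ = rsum (fun t => (f^\+ t + g^\+ t) - (f^\- t + g^\- t))).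
  rewrite rsum_sub_ge0//; [|by move=> t; rewrite addr_ge0..
    |exact: abs_summableD|exact: abs_summableD].
  under eq_esum do rewrite EFinD.
  under [X in _ - fine X]eq_esum do rewrite EFinD.
  rewrite !esumD => [|t _|t _|t _|t _]; rewrite ?lee_fin//.
  rewrite !fineD ?abs_summable_esum_fin// !rsum_posneg//.
  by rewrite opprD addrACA.
congr rsum; apply/funext => t.
by have /(congr1 (fun h => h t)) := funrDB f g.
Qed.

Lemma rsum0 : rsum (fun _ : G => 0 : R) = 0.
Proof. by rewrite rsum_ge0// esum1. Qed.

Lemma rsumN f : abs_summable f -> rsum (fun t => - f t) = - rsum f.
Proof.
move=> sf; apply/eqP; rewrite -addr_eq0 addrC -rsumD//; last first.
  by apply: abs_summable_le sf => t; rewrite normrN.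
by under eq_fun do rewrite subrr; rewrite rsum0.
Qed.

Lemma rsumZ c f : abs_summable f -> rsum (fun t => c * f t) = c * rsum f.
Proof.
move=> sf; have sp := abs_summable_funrpos sf.
have sn := abs_summable_funrneg sf.
(* A non-negative scalar commutes with the supremum over finite partial sums; a negative one is
   reduced to this case at the end by [rsumN]. *)
have esumZ a (h : G -> R) : 0 <= a ->
    \esum_(t in [set: G]) (a * h t)%:E = (a%:E * \esum_(t in [set: G]) (h t)%:E)%E.
  move=> a0; rewrite /esum -ereal_supZl//; last first.
    by apply/set0P; exists 0%E; exists set0; rewrite ?fsbig_set0//; exact: fsets_set0.
  congr ereal_sup; rewrite image_comp; apply: eq_imagel => A [finA _] /=.
  by rewrite !fsbig_finite//= !sumEFin -EFinM mulr_sumr.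
have rsumZ_ge0 a : 0 <= a -> rsum (fun t => a * f t) = a * rsum f.
  move=> a0; rewrite rsum_posneg; last exact: abs_summableZ.
  rewrite ge0_funrposM// ge0_funrnegM// !esumZ// rsum_posneg// mulrBr.
  by rewrite !fineM ?abs_summable_esum_fin.
have [c0|c0] := leP 0 c; first exact: rsumZ_ge0.
rewrite -[c]opprK mulNr -rsumZ_ge0 ?oppr_ge0 ?ltW// -rsumN; last exact: abs_summableZ.
by congr rsum; apply/funext => t; rewrite mulNr.
Qed.

End AbsolutelySummable.

(** * The inner product *)

Section InnerProduct.
Context {R : realType} {G : choiceType}.
Local Notation l2 := (l2 R G).
Local Notation Re := complex.Re.
Local Notation Im := complex.Im.
Implicit Types (f g : G -> R[i]) (u v w : l2) (c : R[i]).

Lemma sqr_normc (z : R[i]) : normc z ^+ 2 = Re z ^+ 2 + Im z ^+ 2.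
Proof. by case: z => a b /=; rewrite sqr_sqrtr// addr_ge0 ?sqr_ge0. Qed.

Lemma normc_ge0 (z : R[i]) : 0 <= normc z.
Proof. by case: z => a b; rewrite sqrtr_ge0. Qed.

Lemma Re_le_normc (z : R[i]) : `|Re z| <= normc z.
Proof.
rewrite -(@ler_pXn2r _ 2) ?nnegrE ?normc_ge0// sqr_normc real_normK ?num_real//.
by rewrite lerDl sqr_ge0.
Qed.

Lemma Im_le_normc (z : R[i]) : `|Im z| <= normc z.
Proof.
rewrite -(@ler_pXn2r _ 2) ?nnegrE ?normc_ge0// sqr_normc real_normK ?num_real//.
by rewrite lerDr sqr_ge0.
Qed.

Lemma normcJ (z : R[i]) : normc z^*%C = normc z.
Proof. by case: z => a b; rewrite /= sqrrN. Qed.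

Lemma mulcJ (z : R[i]) : z * z^*%C = (normc z ^+ 2)%:C%C.
Proof. by case: z => a b; rewrite sqr_normc; simpc; congr (_ +i* _)%C; ring. Qed.

Lemma conjcD (x y : R[i]) : (x + y)^*%C = x^*%C + y^*%C.
Proof. exact: rmorphD. Qed.

Lemma conjcM (x y : R[i]) : (x * y)^*%C = x^*%C * y^*%C.
Proof. exact: rmorphM. Qed.

Definition cabs_summable f : Prop := abs_summable (fun t => normc (f t)).

Lemma cabs_summable_Re f : cabs_summable f -> abs_summable (fun t => Re (f t)).
Proof.
apply: abs_summable_le => t; rewrite (ger0_norm (normc_ge0 _)).
exact: Re_le_normc.
Qed.

Lemma cabs_summable_Im f : cabs_summable f -> abs_summable (fun t => Im (f t)).
Proof.
apply: abs_summable_le => t; rewrite (ger0_norm (normc_ge0 _)).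
exact: Im_le_normc.
Qed.

Lemma csumD f g : cabs_summable f -> cabs_summable g ->
  csum (fun t => f t + g t) = csum f + csum g.
Proof.
move=> sf sg; rewrite /csum; simpc; congr (_ +i* _)%C.
  rewrite -rsumD; [|exact: cabs_summable_Re..].
  by congr rsum; apply/funext => t; rewrite raddfD.
rewrite -rsumD; [|exact: cabs_summable_Im..].
by congr rsum; apply/funext => t; rewrite raddfD.
Qed.

Lemma csumZ c f : cabs_summable f -> csum (fun t => c * f t) = c * csum f.
Proof.
move=> sf; have [sR sI] := (cabs_summable_Re sf, cabs_summable_Im sf).
have sZ (a : R) (h : G -> R) := @abs_summableZ _ _ a h.
case: c => a b; rewrite /csum; simpc; congr (_ +i* _)%C.
  rewrite -mulNr -!rsumZ// -rsumD; [|exact: sZ..].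
  by congr rsum; apply/funext => t; case: (f t) => x y /=; rewrite mulNr.
rewrite -!rsumZ// -rsumD; [|exact: sZ..].
by congr rsum; apply/funext => t; case: (f t) => x y.
Qed.

Lemma csumJ f : cabs_summable f -> csum (fun t => (f t)^*%C) = (csum f)^*%C.
Proof.
move=> sf; rewrite /csum; simpc; congr (_ +i* _)%C.
  by congr rsum; apply/funext => t; case: (f t).
rewrite -rsumN; last exact: cabs_summable_Im.
by congr rsum; apply/funext => t; case: (f t).
Qed.

Lemma l2_summable u : abs_summable (fun t => normc (u t) ^+ 2).
Proof.
rewrite /abs_summable /summable; under eq_esum do rewrite /= ger0_norm ?sqr_ge0//.
exact/asboolP/(l2_funP u).
Qed.

(** The bound [a * b <= a ^+ 2 + b ^+ 2] dominates the products by a summable family. This is what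
    makes [csumD], [csumZ] and [csumJ] applicable to inner products. *)
Lemma l2_inner_summable u v : cabs_summable (fun t => u t * (v t)^*%C).
Proof.
apply: abs_summable_le (abs_summableD (l2_summable u) (l2_summable v)) => t.
rewrite normcM normcJ !ger0_norm ?addr_ge0 ?mulr_ge0 ?normc_ge0 ?sqr_ge0//.
nra.
Qed.

Lemma l2_innerDl u v w : l2_inner (u + v) w = l2_inner u w + l2_inner v w.
Proof.
rewrite /l2_inner -csumD; [|exact: l2_inner_summable..].
by congr csum; apply/funext => t; rewrite -mulrDl.
Qed.

Lemma l2_innerZl c u v : l2_inner (c *: u) v = c * l2_inner u v.
Proof.
rewrite /l2_inner -csumZ; last exact: l2_inner_summable.
by congr csum; apply/funext => t; rewrite mulrA.
Qed.

Lemma l2_innerC u v : l2_inner v u = (l2_inner u v)^*%C.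
Proof.
rewrite /l2_inner -csumJ; last exact: l2_inner_summable.
by congr csum; apply/funext => t; rewrite conjcM conjcK mulrC.
Qed.

Lemma l2_innerDr u v w : l2_inner w (u + v) = l2_inner w u + l2_inner w v.
Proof. by rewrite l2_innerC l2_innerDl conjcD -!l2_innerC. Qed.

Lemma l2_innerZr c u v : l2_inner u (c *: v) = c^*%C * l2_inner u v.
Proof. by rewrite l2_innerC l2_innerZl conjcM -l2_innerC. Qed.

Lemma l2_inner0l v : l2_inner 0 v = 0.
Proof. by rewrite -(scale0r v) l2_innerZl mul0r. Qed.

Lemma l2_innerNl u v : l2_inner (- u) v = - l2_inner u v.
Proof. by rewrite -scaleN1r l2_innerZl mulN1r. Qed.

Lemma l2_innerBl u v w : l2_inner (u - v) w = l2_inner u w - l2_inner v w.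
Proof. by rewrite l2_innerDl l2_innerNl. Qed.

Lemma l2_innerBr u v w : l2_inner w (u - v) = l2_inner w u - l2_inner w v.
Proof.
rewrite -scaleN1r l2_innerDr l2_innerZr.
by have -> : (-1 : R[i])^*%C = -1; [exact: rmorphN1|rewrite mulN1r].
Qed.

Lemma l2_inner_suml k (u : 'I_k -> l2) v :
  l2_inner (\sum_i u i) v = \sum_i l2_inner (u i) v.
Proof.
by apply: (big_morph (fun x => l2_inner x v)) => [x y|]; rewrite ?l2_innerDl ?l2_inner0l.
Qed.

Lemma l2_inner_sumr k (u : 'I_k -> l2) v :
  l2_inner v (\sum_i u i) = \sum_i l2_inner v (u i).
Proof.
rewrite l2_innerC l2_inner_suml rmorph_sum.
by apply: eq_bigr => i _; exact/esym/l2_innerC.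
Qed.

Lemma l2_norm_ge0 u : 0 <= l2_norm u.
Proof. exact: sqrtr_ge0. Qed.

Lemma l2_norm_sqr u : l2_norm u ^+ 2 = rsum (fun t => normc (u t) ^+ 2).
Proof.
rewrite rsum_ge0 => [|t]; last exact: sqr_ge0.
rewrite sqr_sqrtr// fine_ge0// esum_ge0// => t _.
by rewrite lee_fin sqr_ge0.
Qed.

Lemma l2_inner_self u : l2_inner u u = (l2_norm u ^+ 2)%:C%C.
Proof.
rewrite l2_norm_sqr /l2_inner; under eq_fun do rewrite mulcJ.
by rewrite /csum/= rsum0.
Qed.

Lemma l2_norm_eq0 u : l2_norm u = 0 -> u = 0.
Proof.
move=> u0; apply/val_inj/funext => t; apply: eq0_normc; apply/eqP.
rewrite -sqrf_eq0 eq_le sqr_ge0 andbT.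
have := l2_norm_sqr u; rewrite u0 expr0n rsum_ge0 => [s0|s]; last exact: sqr_ge0.
rewrite [X in _ <= X]s0 -lee_fin fineK ?abs_summable_esum_fin//; last 2 first.
- by move=> s; exact: sqr_ge0.
- exact: l2_summable.
(* The term at [t] is split off: it is at most the whole sum, which vanishes. *)
rewrite (esumID [set t]) ?setTI => [|s _]; last by rewrite lee_fin sqr_ge0.
rewrite esum_set1 ?lee_fin ?sqr_ge0// leeDl// esum_ge0// => s _.
by rewrite lee_fin sqr_ge0.
Qed.

Lemma eq_l2_norm u v : (forall t, normc (u t) = normc (v t)) -> l2_norm u = l2_norm v.
Proof.
by move=> uv; rewrite /l2_norm; congr (Num.sqrt (fine _)); apply: eq_esum => t _; rewrite uv.
Qed.

Lemma l2_normZ c u : l2_norm (c *: u) = normc c * l2_norm u.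
Proof.
apply/eqP; rewrite -(@eqrXn2 _ 2) ?mulr_ge0 ?l2_norm_ge0 ?normc_ge0//.
rewrite exprMn !l2_norm_sqr -rsumZ; last exact: l2_summable.
by apply/eqP; congr rsum; apply/funext => t; rewrite -exprMn -normcM.
Qed.

End InnerProduct.

(** * Finite-rank projections *)

Section Orthonormal.
Context {R : realType} {G : choiceType}.
Local Notation l2 := (l2 R G).
Local Notation Re := (@complex.Re R).
Implicit Types (u v : l2) (P : bounded_op R G).

Definition orthonormal_family k (e : 'I_k -> l2) : Prop :=
  forall i j, l2_inner (e i) (e j) = (i == j)%:R.

Definition family_proj k (e : 'I_k -> l2) v : l2 :=
  \sum_i l2_inner v (e i) *: e i.

Lemma orthonormal_coord k (e : 'I_k -> l2) (c : 'I_k -> R[i]) j :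
  orthonormal_family e -> l2_inner (\sum_i c i *: e i) (e j) = c j.
Proof.
move=> oe; rewrite l2_inner_suml (bigD1 j)//= l2_innerZl oe eqxx mulr1.
rewrite big1 ?addr0// => i /negPf ij.
by rewrite l2_innerZl oe ij mulr0.
Qed.

Lemma orthonormal_norm k (e : 'I_k -> l2) i :
  orthonormal_family e -> l2_norm (e i) = 1.
Proof.
move=> oe; have := l2_inner_self (e i); rewrite oe eqxx => /(congr1 Re)/= /esym/eqP.
by rewrite sqrp_eq1 ?l2_norm_ge0// => /eqP.
Qed.

(** If [r < k], the [k] by [r] matrix of coefficients has a non-zero row [u] in its left kernel.
    Then the combination of the [e i] with coefficients [u] vanishes, and pairing it with each [e j]
    gives [u = 0]. *)
Lemma orthonormal_size_le k r (e : 'I_k -> l2) (b : 'I_r -> l2) :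
  orthonormal_family e ->
  (forall i, exists c : 'I_r -> R[i], e i = \sum_j c j *: b j) -> (k <= r)%N.
Proof.
move=> oe /choice[c ec]; rewrite leqNgt; apply/negP => rk.
pose A := \matrix_(i, j) c i j.
have /rowV0Pn[u /sub_kermxP uA u0] : kermx A != 0.
  rewrite kermx_eq0 -row_leq_rank -ltnNge.
  exact: leq_ltn_trans (rank_leq_col A) rk.
have ue0 : \sum_i u 0 i *: e i = 0.
  under eq_bigr do rewrite ec scaler_sumr.
  rewrite exchange_big big1//= => j _.
  under eq_bigr do rewrite scalerA.
  rewrite -scaler_suml.
  have -> : \sum_i u 0 i * c i j = (u *m A) 0 j.
    by rewrite mxE; apply: eq_bigr => i _; rewrite mxE.
  by rewrite uA mxE scale0r.
case/negP: u0; apply/eqP/rowP => j.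
by rewrite mxE -(orthonormal_coord (u 0) j oe) ue0 l2_inner0l.
Qed.

Lemma orthonormal_extend k (e : 'I_k -> l2) v : orthonormal_family e ->
  (forall i, l2_inner v (e i) = 0) -> l2_norm v = 1 ->
  orthonormal_family (fun i : 'I_k.+1 => oapp e v (unlift ord_max i)).
Proof.
move=> oe ve v1 i j.
case: (unliftP ord_max i) => [i' ->|->]; case: (unliftP ord_max j) => [j' ->|->] /=.
- by rewrite (inj_eq (@lift_inj _ _)) oe.
- by rewrite l2_innerC ve eq_sym eq_liftF conjc0.
- by rewrite ve eq_liftF.
- by rewrite eqxx l2_inner_self v1 expr1n.
Qed.

(** A maximal orthonormal family of vectors fixed by [P] is taken; its size is bounded because such
    vectors lie in the span of finitely many. If some [P v] differed from its expansion, the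
    normalized remainder would be a further fixed vector orthogonal to the family, against
    maximality. *)
Lemma fin_proj_basis P : fin_proj P ->
  exists k (e : 'I_k.+1 -> l2),
    orthonormal_family e /\ forall v, P v = family_proj e v.
Proof.
case=> PP Psym [r [b Pb]] [v0 Pv0].
pose fixed k (e : 'I_k -> l2) := orthonormal_family e /\ forall i, P (e i) = e i.
have ex0 : exists k, `[< exists e : 'I_k -> l2, fixed k e >].
  by exists 0%N; apply/asboolP; exists (fun=> 0); split; case.
have bnd k : `[< exists e : 'I_k -> l2, fixed k e >] -> (k <= r)%N.
  move=> /asboolP[e [oe Pe]]; apply: (orthonormal_size_le oe) => i.
  by have [c Pc] := Pb (e i); exists c; rewrite -[LHS]Pe Pc.
case: (ex_maxnP ex0 bnd) => k /asboolP[e [oe Pe]] kmax.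
have PE v : P v = family_proj e v.
  (* Self-adjointness of [P] and [P (e i) = e i] show that [v] and [P v] have the same
     coordinates. *)
  have -> : family_proj e v = \sum_i l2_inner (P v) (e i) *: e i.
    by apply: eq_bigr => i _; rewrite Psym Pe.
  apply/eqP; rewrite -subr_eq0; set w := (X in X == 0).
  apply/negPn/negP => w0.
  have nw0 : l2_norm w != 0 by apply: contra w0 => /eqP/l2_norm_eq0/eqP.
  have we i : l2_inner w (e i) = 0.
    by rewrite l2_innerBl orthonormal_coord// subrr.
  have Pw : P w = w.
    rewrite linearB/= PP linear_sum/=; congr (_ - _).
    by apply: eq_bigr => i _; rewrite linearZ/= Pe.
  pose w1 := ((l2_norm w)^-1%:C)%C *: w.
  have w1n : l2_norm w1 = 1.
    rewrite l2_normZ /= expr0n addr0 sqrtr_sqr ger0_norm ?mulVf//.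
    by rewrite invr_ge0 l2_norm_ge0.
  have /kmax : `[< exists e' : 'I_k.+1 -> l2, fixed k.+1 e' >].
    apply/asboolP; exists (fun i => oapp e w1 (unlift ord_max i)); split.
      by apply: orthonormal_extend => // i; rewrite l2_innerZl we mulr0.
    move=> i; case: (unlift ord_max i) => [j|] /=; first exact: Pe.
    by rewrite linearZ/= Pw.
  by rewrite ltnn.
(* An empty family would give [P = 0], which [fin_proj] excludes; hence the size is a successor. *)
case: k e oe Pe kmax PE => [|k] e oe _ _ PE; last by exists k, e.
by move: Pv0; rewrite PE /family_proj big_ord0 eqxx.
Qed.

(** The case of Cauchy-Schwarz that is used: expanding [0 <= ||u - eps v||^2] gives [2 eps Re <u, v>
    <= ||u||^2 + eps^2 <= 2 eps^2]. *)
Lemma Re_l2_inner_le (eps : R) u v : 0 < eps ->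
  l2_norm u <= eps -> l2_norm v = 1 -> Re (l2_inner u v) <= eps.
Proof.
move=> eps0 ue v1; pose w := u - (eps%:C)%C *: v.
have : 0 <= Re (l2_inner w w) by rewrite l2_inner_self/= sqr_ge0.
have -> : Re (l2_inner w w) =
    l2_norm u ^+ 2 - 2 * eps * Re (l2_inner u v) + eps ^+ 2.
  rewrite l2_innerBl !l2_innerBr !l2_innerZl !l2_innerZr !l2_inner_self v1.
  rewrite (l2_innerC u v); case: (l2_inner u v) => a b; simpc => /=; ring.
have : l2_norm u ^+ 2 <= eps ^+ 2 by rewrite ler_sqr ?nnegrE ?l2_norm_ge0// ltW.
move=> h1 h2; rewrite -(ler_pM2l eps0); nra.
Qed.

(* With [P], [P'] the projections on the two spans and [D = P' - P], the
   identity [D = D P' + P D] gives [Tr(D J) = Tr(D P' J) + Tr(P D J)], and each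
   of the two traces is a sum of [k] inner products of modulus at most [eps].
   Both spans having dimension [k], replacing an indicator by the symmetry
   [J] gains the factor 2 lost by estimating the two terms separately. *)
Lemma trace_symmetry_diff_le k (e e' : 'I_k -> l2) (J : l2 -> l2) (eps : R) :
  0 < eps -> orthonormal_family e -> orthonormal_family e' ->
  (forall v, l2_norm (family_proj e' v - family_proj e v) <= eps * l2_norm v) ->
  (forall u v, l2_inner (J u) v = l2_inner u (J v)) ->
  (forall v, l2_norm (J v) = l2_norm v) ->
  \sum_i Re (l2_inner (e' i) (J (e' i))) - \sum_i Re (l2_inner (e i) (J (e i)))
    <= 2 * k%:R * eps.
Proof.
move=> eps0 oe oe' De Jsym Jn; pose D v := family_proj e' v - family_proj e v.
have fix_proj f i : orthonormal_family f -> family_proj f (f i) = f i :> l2.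
  move=> fo; rewrite /family_proj (bigD1 i)//= fo eqxx scale1r big1 ?addr0//.
  by move=> j /negPf ji; rewrite fo eq_sym ji scale0r.
have DE' i : D (e' i) = e' i - family_proj e (e' i) by rewrite /D fix_proj.
have DE i : D (e i) = family_proj e' (e i) - e i by rewrite /D fix_proj.
have Dle v : l2_norm (D v) <= eps * l2_norm v by exact: De.
(* Cyclicity of the trace: both sides are the double sum of [<e' i, e j> <J (e j), e' i>], that is
   [Tr(J P P')]. *)
clearbody D; have cross : \sum_i l2_inner (family_proj e (e' i)) (J (e' i)) =
             \sum_j l2_inner (J (e j)) (family_proj e' (e j)).
  under eq_bigr do rewrite l2_inner_suml.
  under [RHS]eq_bigr do rewrite l2_inner_sumr.
  rewrite exchange_big; apply: eq_bigr => j _; apply: eq_bigr => i _ /=.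
  by rewrite l2_innerZl l2_innerZr -l2_innerC Jsym.
(* Expanding [D] on each basis produces the two wanted sums and two mixed sums of opposite signs,
   which cancel by [cross]. *)
have -> : \sum_i Re (l2_inner (e' i) (J (e' i))) -
          \sum_i Re (l2_inner (e i) (J (e i))) =
    \sum_i (Re (l2_inner (D (e' i)) (J (e' i))) + Re (l2_inner (D (e i)) (J (e i)))).
  have ReD (x y : R[i]) : Re (x + y) = Re x + Re y by case: x y => ? ? [].
  have ReN (x : R[i]) : Re (- x) = - Re x by case: x.
  have ReJ (x : R[i]) : Re x^*%C = Re x by case: x.
  rewrite big_split; cbv beta.
  under [X in _ = X + _]eq_bigr do rewrite DE' l2_innerBl ReD ReN.
  under [X in _ = _ + X]eq_bigr do rewrite l2_innerC ReJ DE l2_innerBr ReD ReN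
    [l2_inner _ (e _)]Jsym.
  rewrite !big_split !sumrN; cbv beta.
  have Re_sum (F : 'I_k -> R[i]) : \sum_i Re (F i) = Re (\sum_i F i).
    by rewrite (big_morph Re ReD (erefl : Re 0 = 0)).
  rewrite [X in (_ - X) + _]Re_sum cross -Re_sum.
  by rewrite addrA subrK.
have step f i : orthonormal_family f ->
    Re (l2_inner (D (f i)) (J (f i))) <= eps :> R.
  move=> fo; have f1 := orthonormal_norm i fo.
  by apply: Re_l2_inner_le; rewrite ?Jn// (le_trans (Dle _))// f1 mulr1.
apply: (@le_trans _ _ (\sum_(i < k) (2 * eps))).
  by apply: ler_sum => i _; rewrite mulr_natl mulr2n lerD ?step.
by rewrite sumr_const card_ord -[_ *+ k]mulr_natl mulrCA mulrA.
Qed.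

End Orthonormal.

(** * The measure attached to a projection *)

Section Symmetry.
Context {R : realType} {G : choiceType}.
Local Notation l2 := (l2 R G).
Local Notation Re := (@complex.Re R).
Implicit Types (u v : l2) (A B : set G).

(** The values are 1 on [A] and -1 off [A], so that multiplication by this function is a
    self-adjoint isometry, as required of [J] in [trace_symmetry_diff_le]. *)
Definition sgn_indic A (t : G) : R := 2 * \1_A t - 1.

Lemma sgn_indic_sqr A t : sgn_indic A t ^+ 2 = 1.
Proof. by rewrite /sgn_indic indicE; case: (t \in A) => /=; ring. Qed.

Lemma normc_sgn_indic A t (z : R[i]) : normc ((sgn_indic A t)%:C%C * z) = normc z.
Proof.
rewrite normcM /= expr0n addr0 sqrtr_sqr -[RHS]mul1r; congr (_ * _).
by apply/eqP; rewrite -sqrp_eq1// real_normK ?num_real// sgn_indic_sqr.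
Qed.

Lemma sgn_op_subproof A u : (fun t => (sgn_indic A t)%:C%C * u t) \in @l2_pred R G.
Proof.
apply/asboolP; rewrite /square_summable.
under eq_esum do rewrite normc_sgn_indic.
exact/asboolP/(l2_funP u).
Qed.

Definition sgn_op A u : l2 := L2 (sgn_op_subproof A u).

Lemma l2_inner_sgn_op A u v : l2_inner (sgn_op A u) v = l2_inner u (sgn_op A v).
Proof.
congr csum; apply/funext => t /=; rewrite conjcM conjc_real [RHS]mulrCA.
exact/esym/mulrA.
Qed.

Lemma l2_norm_sgn_op A u : l2_norm (sgn_op A u) = l2_norm u.
Proof. by apply: eq_l2_norm => t; exact: normc_sgn_indic. Qed.

(* For [e] a basis of the range of [P], this is [Tr(P 1_A)]. *)
Definition mass k (e : 'I_k -> l2) A : R :=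
  \sum_i rsum (fun t => \1_A t * normc (e i t) ^+ 2).

Lemma abs_summable_indic A u : abs_summable (fun t => \1_A t * normc (u t) ^+ 2).
Proof.
apply: abs_summable_le (l2_summable u) => t.
rewrite normrM ler_piMl// indicE ger0_norm ?lern1//.
by case: (t \in A).
Qed.

Lemma mass_setT k (e : 'I_k -> l2) :
  orthonormal_family e -> mass e [set: G] = k%:R.
Proof.
move=> oe; rewrite /mass -[k in RHS]card_ord -sumr_const; apply: eq_bigr => i _.
under eq_fun do rewrite indicT mul1r.
by rewrite -l2_norm_sqr orthonormal_norm// expr1n.
Qed.

Lemma mass_setU k (e : 'I_k -> l2) A B : A `&` B = set0 ->
  mass e (A `|` B) = mass e A + mass e B.
Proof.
move=> AB; rewrite /mass -big_split; apply: eq_bigr => i _ /=.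
rewrite -rsumD; [|exact: abs_summable_indic..].
congr rsum; apply/funext => t; rewrite -mulrDl; congr (_ * _).
rewrite !indicE in_setU; have [tA|] := boolP (t \in A); last by rewrite add0r.
case: (boolP (t \in B)) => [tB|_]; last by rewrite addr0.
by move: tA tB; rewrite !inE => tA tB; have : (A `&` B) t by []; rewrite AB.
Qed.

Lemma mass_set0 k (e : 'I_k -> l2) : mass e set0 = 0.
Proof.
rewrite /mass big1// => i _; under eq_fun do rewrite indic0 mul0r.
exact: rsum0.
Qed.

Lemma mass_bigcup k (e : 'I_k -> l2) n (A : 'I_n -> set G) :
  trivIset [set: 'I_n] A -> mass e (\bigcup_i A i) = \sum_i mass e (A i).
Proof.
elim: n A => [|n IHn] A tA.
  by rewrite big_ord0 (_ : \bigcup_i A i = set0) ?mass_set0// -subset0 => t [[]].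
rewrite big_ord_recl -IHn; last first.
  by move=> i j _ _ /(tA _ _ I I) /lift_inj.
rewrite -mass_setU; last first.
  rewrite -subset0 => t [t0 [i _ ti]].
  have /(tA _ _ I I)/eqP : A ord0 `&` A (lift ord0 i) !=set0 by exists t.
  by rewrite (negPf (neq_lift _ _)).
congr (mass e _); apply/seteqP; split => [t [i _]|t [ti|[i _ ti]]].
- by case: (unliftP ord0 i) => [j ->|->] ti; [right; exists j|left].
- by exists ord0.
- by exists (lift ord0 i).
Qed.

(** This is [Tr(P (2 1_A - 1))]. In a difference for two families of equal size the [k] drops out,
    and the 2 cancels the factor 2 of the trace bound. *)
Lemma Re_inner_sgn_op k (e : 'I_k -> l2) A : orthonormal_family e ->
  \sum_i Re (l2_inner (e i) (sgn_op A (e i))) = 2 * mass e A - k%:R.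
Proof.
move=> oe; rewrite -(mass_setT oe) /mass mulr_sumr -sumrB.
apply: eq_bigr => i _; rewrite -rsumZ; last exact: abs_summable_indic.
rewrite -mulN1r -rsumZ; last exact: abs_summable_indic.
rewrite -rsumD; [|exact/abs_summableZ/abs_summable_indic..].
congr rsum; apply/funext => t /=.
rewrite conjcM conjc_real mulrCA mulcJ indicT /sgn_indic; simpc => /=.
ring.
Qed.

End Symmetry.

(** * Translations and the measure of a translated set *)

Section Translation.
Context {R : realType} {G : groupType}.
Local Notation l2 := (l2 R G).
Implicit Types (u v : l2) (A : set G) (s : G).

Lemma rsum_trans (f : G -> R) s : rsum (fun t => f (s^-1 * t)%g) = rsum f.
Proof.
rewrite /rsum; congr (fine (_ - _)%E).
  by apply: (esum_trans (a := fun t => (f^\+ t)%:E)) => t; rewrite lee_fin.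
by apply: (esum_trans (a := fun t => (f^\- t)%:E)) => t; rewrite lee_fin.
Qed.

Lemma l2_inner_left_reg s u v :
  l2_inner (left_reg R s u) (left_reg R s v) = l2_inner u v.
Proof.
rewrite /l2_inner /csum; congr (_ +i* _)%C.
  exact: (rsum_trans (fun t => complex.Re (u t * (v t)^*%C))).
exact: (rsum_trans (fun t => complex.Im (u t * (v t)^*%C))).
Qed.

Lemma left_regVK s : cancel (left_reg R s^-1) (left_reg R s : l2 -> l2).
Proof. by move=> u; apply/val_inj/funext => t /=; rewrite invgK mulVKg. Qed.

Lemma l2_norm_left_reg s u : l2_norm (left_reg R s u) = l2_norm u.
Proof.
by rewrite /l2_norm (esum_trans (a := fun t => (normc (u t) ^+ 2)%:E))// => t;
  rewrite lee_fin sqr_ge0.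
Qed.

(** The translated family spans the range of [lambda_s^* P lambda_s], so conjugating the projection
    amounts to translating the set. *)
Lemma mass_left_reg k (e : 'I_k -> l2) s A :
  mass (fun i => left_reg R s^-1 (e i)) A = mass e (ltranslate s A).
Proof.
apply: eq_bigr => i _; rewrite -(rsum_trans _ s); congr rsum; apply/funext => t /=.
rewrite invgK mulVKg; congr (_ * _); rewrite !indicE; congr ((nat_of_bool _)%:R).
apply/idP/idP; rewrite !inE; first by exists (s^-1 * t)%g; rewrite ?mulVKg.
by move=> [x Ax <-]; rewrite mulKg.
Qed.

(* [2 Tr(P 1_(sA)) - 2 Tr(P 1_A) = Tr(lambda_s^* P lambda_s J) - Tr(P J)]
   with [J = 1_A - 1_(~A)]. *)
Lemma mass_ltranslate_le k (e : 'I_k -> l2) (eps : R) s A :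
  0 < eps -> orthonormal_family e ->
  (forall v, l2_norm (left_reg R s (family_proj e v) - family_proj e (left_reg R s v))
             <= eps * l2_norm v) ->
  mass e (ltranslate s A) <= mass e A + k%:R * eps.
Proof.
move=> eps0 oe comm; pose e' i := left_reg R s^-1 (e i).
have oe' : orthonormal_family e' by move=> i j; rewrite l2_inner_left_reg.
have proj' v : family_proj e' v = left_reg R s^-1 (family_proj e (left_reg R s v)).
  rewrite /family_proj linear_sum; apply: eq_bigr => i _ /=.
  rewrite [RHS]linearZ; congr (_ *: _).
  by rewrite -(l2_inner_left_reg s) left_regVK.
have De v : l2_norm (family_proj e' v - family_proj e v) <= eps * l2_norm v.
  (* Applying the isometry [lambda_s] to the difference of the two projections turns it into the
     commutator at [v], up to sign. *)
  apply: le_trans (comm v); rewrite proj' -(l2_norm_left_reg s).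
  rewrite linearB/= left_regVK -opprB -scaleN1r l2_normZ.
  by rewrite normcN normc1 mul1r.
have := trace_symmetry_diff_le eps0 oe oe' De (l2_inner_sgn_op A) (l2_norm_sgn_op A).
rewrite !Re_inner_sgn_op// mass_left_reg; lra.
Qed.

End Translation.

(** * Existence of projections *)

Section RankOneProjection.
Context {R : realType} {G : choiceType}.
Local Notation l2 := (l2 R G).
Implicit Types (u v : l2).
Context (d : l2) (d1 : l2_norm d = 1).

Definition rank1_fun v : l2 := l2_inner v d *: d.

Lemma rank1_linear : linear rank1_fun.
Proof.
by move=> c u v; rewrite /rank1_fun l2_innerDl l2_innerZl scalerDl scalerA.
Qed.

HB.instance Definition _ :=
  GRing.isLinear.Build R[i] l2 l2 _ rank1_fun rank1_linear.

Lemma l2_inner_self1 : l2_inner d d = 1.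
Proof. by rewrite l2_inner_self d1 expr1n. Qed.

(** By Pythagoras, the squared norm of [v] exceeds that of its projection by the squared norm of the
    remainder. *)
Lemma rank1_bounded :
  exists M : R, forall v, l2_norm (rank1_fun v) <= M * l2_norm v.
Proof.
exists 1 => v; rewrite mul1r -ler_sqr ?nnegrE ?l2_norm_ge0//.
rewrite -subr_ge0 (_ : _ - _ = l2_norm (v - rank1_fun v) ^+ 2) ?sqr_ge0//.
apply: complexI; rewrite rmorphB/= -!l2_inner_self.
rewrite l2_innerBl !l2_innerBr !l2_innerZl !l2_innerZr l2_inner_self1.
by rewrite (l2_innerC v d); ring.
Qed.

Definition rank1 : bounded_op R G := BoundedOp rank1_bounded.

Lemma fin_proj_rank1 : fin_proj rank1.
Proof.
split=> [v|u v||].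
- by rewrite /= /rank1_fun l2_innerZl l2_inner_self1 mulr1.
- by rewrite /= /rank1_fun l2_innerZl l2_innerZr (l2_innerC v d) mulrC.
- by exists 1%N, (fun=> d) => v; exists (fun=> l2_inner v d); rewrite big_ord1.
- exists d; rewrite /= /rank1_fun l2_inner_self1 scale1r.
  apply/eqP => d0; move: d1; rewrite d0 -(scale0r d) l2_normZ.
  by rewrite [normc _](normc0 R) mul0r => /esym/eqP; rewrite oner_eq0.
Qed.

End RankOneProjection.

Section Delta.
Context (R : realType) (G : choiceType) (s : G).

Let delta_fun (t : G) : R[i] := (t == s)%:R.

Let esum_delta : (\esum_(t in [set: G]) (normc (delta_fun t) ^+ 2)%:E = 1)%E.
Proof.
rewrite (esumID [set s]) => [|t _]; last by rewrite lee_fin sqr_ge0.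
rewrite setTI esum_set1 ?lee_fin ?sqr_ge0// [X in (_ + X)%E]esum1 => [|t [_ /= ts]].
  by rewrite /delta_fun eqxx [normc _](normc1 R) expr1n adde0.
by rewrite /delta_fun (negPf (introN eqP ts)) [normc _](normc0 R) expr0n.
Qed.

(** [qd] is a supremum over projections, so bounding it below requires at least one; the projection
    onto a delta function serves. *)
Lemma exists_fin_proj : exists P : bounded_op R G, fin_proj P.
Proof.
have dP : delta_fun \in @l2_pred R G.
  by apply/asboolP; rewrite /square_summable esum_delta ltry.
have d1 : l2_norm (L2 dP) = 1 by rewrite /l2_norm esum_delta sqrtr1.
by exists (rank1 d1); exact: fin_proj_rank1.
Qed.

End Delta.

(** * The commutator estimate *)

Section OperatorNorm.
Context {R : realType} {G : choiceType}.
Local Notation l2 := (l2 R G).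

Lemma op_norm_ge0 (T : {linear l2 -> l2}) : (0 <= op_norm T)%E.
Proof.
have n0 : l2_norm (0 : l2) = 0.
  by rewrite -(scale0r 0) l2_normZ [normc _](normc0 R) mul0r.
by apply: ereal_sup_ubound; exists 0; rewrite /= ?n0// linear0 n0.
Qed.

Lemma op_norm_le (T : {linear l2 -> l2}) (eps : R) (v : l2) :
  (op_norm T <= eps%:E)%E -> l2_norm (T v) <= eps * l2_norm v.
Proof.
move=> Te; have [v0|v0] := eqVneq (l2_norm v) 0.
  by rewrite v0 mulr0 (l2_norm_eq0 v0) linear0 -(l2_norm_eq0 v0) v0.
have vgt0 : 0 < l2_norm v by rewrite lt_def v0 l2_norm_ge0.
have ninv : normc ((l2_norm v)^-1%:C)%C = (l2_norm v)^-1.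
  by rewrite /= expr0n addr0 sqrtr_sqr ger0_norm// invr_ge0 ltW.
rewrite -ler_pdivrMr// mulrC -ninv -l2_normZ -linearZ -lee_fin.
apply: le_trans Te; apply: ereal_sup_ubound.
by exists (((l2_norm v)^-1%:C)%C *: v) => //=; rewrite l2_normZ ninv mulVf.
Qed.

End OperatorNorm.

Section Paradoxical.
Context {R : realType} {G : groupType}.
Local Notation l2 := (l2 R G).

Lemma mass_pieces_ge k (e : 'I_k -> l2) (eps : R) n (g : 'I_n -> G)
    (X : 'I_n -> set G) i0 :
  orthonormal_family e -> g i0 = 1%g ->
  trivIset [set: 'I_n] (fun i => ltranslate (g i) (X i)) ->
  \bigcup_i ltranslate (g i) (X i) = [set: G] ->
  (forall i, mass e (ltranslate (g i) (X i)) <= mass e (X i) + k%:R * eps) ->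
  k%:R <= \sum_i mass e (X i) + (n%:R - 1) * (k%:R * eps).
Proof.
move=> oe g1 tX cX le_mass; rewrite -[X in X <= _](mass_setT oe) -cX mass_bigcup//.
rewrite (bigD1 i0)//= [X in _ <= X + _](bigD1 i0)//= -addrA.
have -> : ltranslate (g i0) (X i0) = X i0.
  rewrite g1; apply/seteqP; split => [t [x ? <-]|t ?]; first by rewrite mul1g.
  by exists t; rewrite ?mul1g.
rewrite lerD2l; apply: (le_trans (ler_sum _ (fun i _ => le_mass i))).
rewrite big_split lerD2l sumr_const cardC1 card_ord /= -[_ *+ _]mulr_natl.
(* The index [i0] shows [n > 0], so the truncated [n - 1] agrees with the real one. *)
by rewrite -subn1 natrB//; exact: leq_ltn_trans (ltn_ord i0).
Qed.

Context (n m : nat) (g : 'I_n -> G) (X : 'I_n -> set G).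
Context (h : 'I_m -> G) (Y : 'I_m -> set G) (para : paradoxical g X h Y).
Let F := translators g h.

Lemma paradoxical_almost_invariant (P : bounded_op R G) (eps : R) :
  0 < eps -> fin_proj P ->
  (forall s v, F s -> l2_norm (commutator (left_reg R s) P v) <= eps * l2_norm v) ->
  1 <= (n%:R + m%:R - 2) * eps.
Proof.
move=> eps0 /fin_proj_basis[k [e [oe PE]]] comm.
have le_mass s A : F s -> mass e (ltranslate s A) <= mass e A + k.+1%:R * eps.
  move=> Fs; apply: mass_ltranslate_le => // v.
  by rewrite -!PE; exact: comm.
case: para => -[n0 g1] [m0 h1] tX tY XY cover tgX gX thY hY.
have hX : k.+1%:R <= \sum_i mass e (X i) + (n%:R - 1) * (k.+1%:R * eps).
  by apply: mass_pieces_ge g1 tgX gX _ => // i; apply: le_mass; left; exists i.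
have hYm : k.+1%:R <= \sum_j mass e (Y j) + (m%:R - 1) * (k.+1%:R * eps).
  by apply: mass_pieces_ge h1 thY hY _ => // j; apply: le_mass; right; exists j.
have total : \sum_i mass e (X i) + \sum_j mass e (Y j) = k.+1%:R.
  rewrite -!mass_bigcup// -mass_setU ?cover ?mass_setT//.
  rewrite -subset0 => t [[i _ Xt] [j _ Yt]].
  by have : (X i `&` Y j) t by []; rewrite XY.
have k0 : 0 < k.+1%:R :> R by rewrite ltr0n.
rewrite -(ler_pM2l k0); nra.
Qed.

(** If the supremum were some [r < c], the midpoint [eps] of [r] and [c] would be positive even for
    [r = 0], would bound all the commutators, and would satisfy [eps < c], against
    [1 <= c^-1 * eps]. For [n + m = 2] the convention [0^-1 = 0] leaves only [S >= 0] to prove. *)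
Lemma paradoxical_sup_commutator_ge (P : bounded_op R G) : fin_proj P ->
  ((n%:R + m%:R - 2)^-1%:E <=
   ereal_sup [set op_norm (commutator (left_reg R s) P) | s in F])%E.
Proof.
move=> finP; set c := (_ + _ - _)^-1; set S := ereal_sup _.
have opS s : F s -> (op_norm (commutator (left_reg R s) P) <= S)%E.
  by move=> Fs; apply: ereal_sup_ubound; exists s.
have S0 : (0 <= S)%E.
  (* The set [F] is non-empty, so [S] is not the supremum [-oo] of the empty set. *)
  have [n0 _] := paradoxical_g1 para.
  apply: le_trans (opS (g (Ordinal n0)) _); first exact: op_norm_ge0.
  by left; exists (Ordinal n0).
rewrite leNgt; apply/negP => Sc.
have [r Sr] : exists r : R, S = r%:E.
  by case: (S) S0 Sc => [r|//|//]; exists r.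
rewrite Sr lee_fin in S0; rewrite Sr lte_fin in Sc.
pose eps := (r + c) / 2.
have eps0 : 0 < eps by rewrite /eps; lra.
have : 1 <= (n%:R + m%:R - 2) * eps.
  apply: (paradoxical_almost_invariant eps0 finP) => s v Fs.
  apply: op_norm_le; apply: (le_trans (opS s Fs)).
  by rewrite Sr lee_fin /eps; lra.
have c0 : 0 < c by lra.
have -> : n%:R + m%:R - 2 = c^-1 :> R by rewrite invrK.
rewrite mulrC ler_pdivlMr// mul1r /eps; lra.
Qed.

Lemma paradoxical_commutator_const_ge :
  ((n%:R + m%:R - 2)^-1%:E <= commutator_const R F)%E.
Proof.
by apply: le_ereal_inf_tmp => _ [P finP <-]; exact: paradoxical_sup_commutator_ge.
Qed.

(** The bound holds for every finite-rank projection, hence for the infimum over those above a fixed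
    [P]; one such [P] bounds the outer supremum. *)
Lemma paradoxical_qd_ge :
  ((n%:R + m%:R - 2)^-1%:E <= qd (left_reg R @` F))%E.
Proof.
have [P finP] := exists_fin_proj R (1%g : G).
apply: (@le_trans _ _ (ereal_inf [set
    ereal_sup [set op_norm (commutator T Q) | T in left_reg R @` F]
  | Q in [set Q | fin_proj Q /\ proj_le P Q]])); last first.
  by apply: ereal_sup_ubound; exists P.
apply: le_ereal_inf_tmp => _ [Q [finQ _] <-].
by rewrite image_comp; exact: paradoxical_sup_commutator_ge.
Qed.

End Paradoxical.

(** * A four-piece decomposition from a free subgroup *)

Lemma mem_ltranslate (G : groupType) (s t : G) (A : set G) :
  ltranslate s A t = A (s^-1 * t)%g.
Proof.
apply/propext; split => [[x Ax <-]|At]; first by rewrite mulKg.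
by exists (s^-1 * t)%g; rewrite ?mulVKg.
Qed.

Lemma ltranslate1 (G : groupType) (A : set G) : ltranslate 1%g A = A.
Proof. by apply/funext => t; rewrite mem_ltranslate invg1 mul1g. Qed.

Section FreeGroup.
Implicit Types (x : letter) (w : seq letter).

Definition starts x w : bool := ohead w == Some x.

(** If [w] begins with [x], the two letters cancel, and the tail cannot begin with [linv x] because
    [w] is reduced. Otherwise [linv x] is simply prepended. *)
Lemma starts_push_linv x w : reduced w ->
  starts (linv x) (push (linv x) w) = ~~ starts x w.
Proof.
case: w => [|y w] /=; first by rewrite /starts /= eqxx.
rewrite linvK /starts /= => yw.
have -> : (Some y == Some x) = (y == x) by [].
have [yx|yx] := eqVneq y x; last by rewrite eqxx.
case: w yw => //= z w /andP[zy _]; rewrite -yx.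
by apply/negbTE.
Qed.

Definition letter_elt x : F2 := @ReducedWord [:: x] isT.

End FreeGroup.

(** * Equivariant maps onto an embedded subgroup *)

Section EquivariantMap.
Context (H G : groupType) (phi : {multiplicative H -> G}).

Lemma multiplicative1 : phi 1%g = 1%g.
Proof. by apply: (mulgI (phi 1%g)); rewrite -gmulfM !mulg1. Qed.

Lemma multiplicativeV u : phi u^-1%g = (phi u)^-1%g.
Proof. by apply: (mulgI (phi u)); rewrite -gmulfM !mulgV multiplicative1. Qed.

(** [S x] is the coset [phi(H) x]. With one representative [r] chosen per coset, [x = phi(u) r] has
    a unique [u] by injectivity, and [x] is sent to it. Preimages under this map carry a
    decomposition of [H] over to [G]. *)
Lemma exists_equivariant : injective phi ->
  exists f : G -> H, forall u x, f (phi u * x)%g = (u * f x)%g.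
Proof.
move=> phi_inj; pose S (x : G) := [set y | exists u, (phi u * y)%g = x].
pose r x := xget 1%g (S x).
have Sr x : exists u, (phi u * r x)%g = x.
  by apply: (@xgetPex _ 1%g (S x)); exists x, 1%g; rewrite multiplicative1 mul1g.
have SM u x : S (phi u * x)%g = S x.
  apply/seteqP; split => y [v vy].
    by exists (u^-1 * v)%g; rewrite gmulfM -mulgA vy multiplicativeV mulKg.
  by exists (u * v)%g; rewrite gmulfM -mulgA vy.
exists (fun x => projT1 (cid (Sr x))) => u x.
case: cid => v /= vE; case: cid => w /= wE.
apply/phi_inj/(mulIg (r x)); rewrite gmulfM -mulgA wE -vE.
by rewrite /r SM.
Qed.

End EquivariantMap.

Section TwoPieces.
Context (T : Type).
Implicit Types (A B : set T).

Definition two_sets A B (i : 'I_2) : set T := if i == ord0 then A else B.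

Lemma trivIset_two_sets A B : A `&` B = set0 -> trivIset [set: 'I_2] (two_sets A B).
Proof.
move=> AB i j _ _; rewrite /two_sets.
case: (unliftP ord0 i) => [i' ->|->]; case: (unliftP ord0 j) => [j' ->|->] //=.
- by rewrite !ord1.
- by rewrite setIC AB => -[].
- by rewrite AB => -[].
Qed.

Lemma bigcup_two_sets A B : \bigcup_i two_sets A B i = A `|` B.
Proof.
apply/seteqP; split => [t [i _]|t [tA|tB]].
- by rewrite /two_sets; case: ifP; [left|right].
- by exists ord0.
- by exists (lift ord0 ord0).
Qed.

End TwoPieces.

Section FreeSubgroup.
Context (G : groupType) (phi : {multiplicative F2 -> G}).
Context (f : G -> F2) (fM : forall u x, f (phi u * x)%g = (u * f x)%g).

Let gen_a : letter := (false, false).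
Let gen_b : letter := (true, false).

(** These are the words [a^-n] with [n >= 0], the empty word included. *)
Let nonpos_power (w : F2) : bool := all (pred1 (linv gen_a)) w.

Let X1 := [set t | starts gen_a (f t) || nonpos_power (f t)].
Let X2 := [set t | starts (linv gen_a) (f t) && ~~ nonpos_power (f t)].
Let Y1 := [set t | starts gen_b (f t)].
Let Y2 := [set t | starts (linv gen_b) (f t)].

Let f_letterV x t : F2_word (f ((phi (letter_elt x))^-1 * t)%g) = push (linv x) (f t).
Proof. by rewrite -multiplicativeV fM. Qed.

(** A point [t] lies in the translate when [a^-1 f(t)] begins with [a^-1] and is no power of it. The
    former means that [f t] does not begin with [a]; then nothing cancels, and the latter means that
    [f t] is not some [a^-n]. *)
Let ltranslateX2 : ltranslate (phi (letter_elt gen_a)) X2 = ~` X1.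
Proof.
apply/funext => t; rewrite mem_ltranslate /X2 /X1 /= /nonpos_power f_letterV.
rewrite starts_push_linv ?F2_wordP//; apply/propext.
rewrite (rwP negP) negb_or; case: (F2_word (f t)) => [|y w] //=.
rewrite linvK /starts /=.
by have [->|] := eqVneq y gen_a.
Qed.

Let ltranslateY2 : ltranslate (phi (letter_elt gen_b)) Y2 = ~` Y1.
Proof.
apply/funext => t; rewrite mem_ltranslate /Y2 /Y1 /= f_letterV.
by rewrite starts_push_linv ?F2_wordP//; apply/propext; rewrite (rwP negP).
Qed.

(* The words [a^-n] are moved from the words beginning with [a^-1] to those
   beginning with [a], so that the four pieces also cover the identity. *)
Lemma paradoxical_free :
  paradoxical
    (fun i : 'I_2 => if i == ord0 then 1%g else phi (letter_elt gen_a)) (two_sets X1 X2)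
    (fun i : 'I_2 => if i == ord0 then 1%g else phi (letter_elt gen_b)) (two_sets Y1 Y2).
Proof.
have tr s (A B : set G) : ltranslate s B = ~` A ->
    (fun i : 'I_2 => ltranslate (if i == ord0 then 1%g else s) (two_sets A B i)) =
    two_sets A (~` A).
  move=> sB; apply/funext => i; rewrite /two_sets; case: ifP => _ //.
  exact: ltranslate1.
have disj (A B : set G) : (forall t, A t -> B t -> False) -> A `&` B = set0.
  by move=> AB; rewrite -subset0 => t [/AB].
split.
- by exists isT.
- by exists isT.
- apply/trivIset_two_sets/disj => t; rewrite /X1 /X2 /= => /orP[+ /andP[+ _]|-> /andP[]//].
  by rewrite /starts => /eqP ->.
- by apply/trivIset_two_sets/disj => t; rewrite /Y1 /Y2 /= /starts => /eqP ->.
- move=> i j; rewrite /two_sets; case: ifP => _; case: ifP => _; apply: disj => t;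
    rewrite /X1 /X2 /Y1 /Y2 /= /nonpos_power /starts;
    by case: (F2_word (f t)) => [|[[] []] w].
- rewrite !bigcup_two_sets -subTset => t _.
  rewrite /X1 /X2 /Y1 /Y2 /= /nonpos_power /starts.
  (* The cases are the empty word, then the first letters [b^-1], [b], [a^-1], [a]. *)
  case: (F2_word (f t)) => [|[[] []] w] /=.
  + by left; left.
  + by right; right.
  + by right; left.
  + by left; case: (all _ _); [left|right].
  + by left; left.
- by rewrite (tr _ _ _ ltranslateX2); apply/trivIset_two_sets/setICr.
- by rewrite (tr _ _ _ ltranslateX2) bigcup_two_sets setUv.
- by rewrite (tr _ _ _ ltranslateY2); apply/trivIset_two_sets/setICr.
- by rewrite (tr _ _ _ ltranslateY2) bigcup_two_sets setUv.
Qed.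

End FreeSubgroup.

Unset Implicit Arguments.

Theorem theorem2p4 (R : realType) (G : groupType)
    (countable_G : countable [set: G]) :
  (~ amenable R G ->
   forall (n m : nat) (g : 'I_n -> G) (X : 'I_n -> set G)
          (h : 'I_m -> G) (Y : 'I_m -> set G),
     paradoxical g X h Y ->
     let F := translators g h in
     ((n%:R + m%:R - 2)^-1%:E <= commutator_const R F)%E /\
     ((n%:R + m%:R - 2)^-1%:E <= qd (left_reg R @` F))%E)
  /\
  (contains_F2 G ->
   exists (n m : nat) (g : 'I_n -> G) (X : 'I_n -> set G)
          (h : 'I_m -> G) (Y : 'I_m -> set G),
     let F := translators g h in
     [/\ paradoxical g X h Y, (n + m = 4)%N,
         ((2^-1)%:E <= commutator_const R F)%E &
         ((2^-1)%:E <= qd (left_reg R @` F))%E]).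
Proof.
split=> [_ n m g X h Y para F|[phi /exists_equivariant[f fM]]].
  split; [exact: (paradoxical_commutator_const_ge para)|exact: (paradoxical_qd_ge para)].
have para := paradoxical_free fM.
(* Both families have two pieces, so the general bound reads [1 / (2 + 2 - 2)]. *)
have two : (2 : R)^-1 = (2%:R + 2%:R - 2)^-1 by rewrite addrK.
do 6 eexists; split; first exact: para.
- by [].
- by rewrite two; exact: (paradoxical_commutator_const_ge para).
- by rewrite two; exact: (paradoxical_qd_ge para).
Qed.
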